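(* Let $\mathcal{I}$ be an ideal on $\omega$ such that $\mathcal{ED}\not\leq_{\mathrm{K}}\mathcal{I}\restriction A$ for all $A\in\mathcal{I}^+$. Then for every $\boldsymbol{a}\in\mathbb{Z}^\omega$ we have $\mathsf{H}_{\boldsymbol{a}}(\mathcal{I})=\mathbb{T}$ if and only if $\mathrm{supp}(\boldsymbol{a})\in\mathcal{I}$.
   Context: $\omega=\{0,1,2,\dots\}$; $\mathbb{T}=\mathbb{R}/\mathbb{Z}$; $\|x\|:=\min\{|x-z|:z\in\mathbb{Z}\}$. An ideal on a countably infinite set $X$ is a family $\mathcal{I}\subseteq\mathcal{P}(X)$ closed under subsets and finite unions, containing all finite subsets of $X$, and with $X\notin\mathcal{I}$; $\mathcal{I}^+:=\mathcal{P}(X)\setminus\mathcal{I}$. For $A\in\mathcal{I}^+$, $\mathcal{I}\restriction A:=\{B\cap A:B\in\mathcal{I}\}$, an ideal on $A$. For ideals $\mathcal{I}$ on $X$ and $\mathcal{J}$ on $Y$, $\mathcal{I}\leq_{\mathrm{K}}\mathcal{J}$ (Katětov order) if there is $f:Y\to X$ with $f^{-1}[A]\in\mathcal{J}$ for every $A\in\mathcal{I}$. $\mathcal{ED}$ is the ideal on $\omega^2$ given by $\mathcal{ED}:=\{A\subseteq\omega^2:\sup_{i>k}|A_i|<\infty\text{ for some }k\in\omega\}$, where $A_i:=\{j\in\omega:(i,j)\in A\}$. For $\boldsymbol{a}=(a_n:n\in\omega)\in\mathbb{Z}^\omega$, $\mathrm{supp}(\boldsymbol{a}):=\{n\in\omega:a_n\ne0\}$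 and $\mathsf{H}_{\boldsymbol{a}}(\mathcal{I}):=\{x\in\mathbb{T}:\{n\in\omega:\|a_nx\|\ge\varepsilon\}\in\mathcal{I}\text{ for all }\varepsilon>0\}$. *)

(* Defs.v *)
From HB Require Import structures.
From mathcomp Require Import all_boot all_order all_algebra.
From mathcomp Require Import generic_quotient ring_quotient.
From mathcomp Require Import boolp classical_sets functions cardinality.
From mathcomp Require Import reals.

Set Implicit Arguments.
Unset Strict Implicit.
Unset Printing Implicit Defensive.

Import Order.TTheory GRing.Theory Num.Theory.

Local Open Scope classical_set_scope.
Local Open Scope card_scope.
Local Open Scope ring_scope.
Local Open Scope quotient_scope.

(* An ideal lives on a carrier set [X : set T] rather than on a whole type, so
   that the restriction of an ideal on [T] to a subset [A] is again an ideal,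
   on [A], without passing to a subtype. *)
Record is_ideal (T : Type) (X : set T) (I : set (set T)) : Prop := IsIdeal {
  ideal_carrier : X #= [set: nat];
  ideal_sub : forall A, I A -> A `<=` X;
  ideal_down : forall A B, A `<=` B -> I B -> I A;
  ideal_union : forall A B, I A -> I B -> I (A `|` B);
  ideal_finite : forall A, A `<=` X -> finite_set A -> I A;
  ideal_proper : ~ I X
}.

Definition ideal_pos (T : Type) (X : set T) (I : set (set T)) : set (set T) :=
  [set A | A `<=` X /\ ~ I A].

Definition ideal_restr (T : Type) (I : set (set T)) (A : set T) :
    set (set T) :=
  [set B `&` A | B in I].

(* [I] is a family on [X] and [J] a family on [Y]. Only the values of [f] on
   [Y] matter, so [f] stands for a function from [Y] to [X]. *)
Definition katetov_le (T U : Type) (X : set T) (I : set (set T))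
    (Y : set U) (J : set (set U)) : Prop :=
  exists f : U -> T, set_fun Y X f /\
    forall A, I A -> J (Y `&` f @^-1` A).

(* [sup_{i > k} |A_i| < oo] is a common natural bound [N] for the
   cardinalities of the sections [A_i]. *)
Definition ED : set (set (nat * nat)) :=
  [set A | exists k N : nat, forall i : nat, (k < i)%N ->
    [set j | A (i, j)] #<= `I_N].

(* [Num.int] as an additive subgroup: [Num.int_num_subdef] is the predicate
   underlying the qualifier [Num.int]. *)
Definition int_subgroup (R : realType) : zmodClosed R :=
  GRing.ZmodClosed.clone R Num.int_num_subdef _.

Definition circle (R : realType) : Type := Quotient.quot (int_subgroup R).
HB.instance Definition _ (R : realType) := GRing.Zmodule.on (circle R).
HB.instance Definition _ (R : realType) :=
  EqQuotient.copy (circle R) (Quotient.quot (int_subgroup R)).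

(* The infimum is a minimum, see [distZ_attained]. *)
Definition distZ (R : realType) (x : R) : R :=
  inf [set `|x - z%:~R| | z in [set: int]].

(* Independent of the representative, see [circle_normE]. *)
Definition circle_norm (R : realType) (x : circle R) : R :=
  distZ (repr x).

Definition supp (a : nat -> int) : set nat := [set n | a n != 0].

Definition H_set (R : realType) (a : nat -> int) (I : set (set nat)) :
    set (circle R) :=
  [set x | forall e : R, 0 < e -> I [set n | e <= circle_norm (x *~ a n)]].

Section Facts.
Variable R : realType.
Implicit Types x y : R.

Lemma distZ_attained x :
  (exists z : int, distZ x = `|x - z%:~R|) /\
  (forall z : int, distZ x <= `|x - z%:~R|).
Proof.
set S := [set `|x - z%:~R| | z in [set: int]].
have Slb : has_lbound S by exists 0 => _ [z _ <-]; apply: normr_ge0.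
have lbS z : distZ x <= `|x - z%:~R| by apply: ge_inf => //; exists z.
split=> //.
pose f := Num.floor x.
have f1 : f%:~R <= x by apply: real_floor_le; apply: num_real.
have f2 : x < (f + 1)%:~R by apply: real_floorD1_gt; apply: num_real.
pose m := if `|x - f%:~R| <= `|x - (f + 1)%:~R| then f else f + 1.
have mf : `|x - m%:~R| <= `|x - f%:~R|.
  by rewrite /m; case: ifP => // /negbT; rewrite -ltNge => /ltW.
have mg : `|x - m%:~R| <= `|x - (f + 1)%:~R|.
  by rewrite /m; case: ifP.
exists m; apply/eqP; rewrite eq_le lbS /=.
apply: lb_le_inf; first by exists `|x - 0%:~R|; exists 0.
move=> _ [z _ <-]; case: (leP z f) => zf.
  apply: le_trans mf _.
  have zf' : z%:~R <= f%:~R :> R by rewrite ler_int.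
  rewrite !ger0_norm ?subr_ge0 ?(le_trans zf') //.
  by rewrite lerB.
apply: le_trans mg _.
have zf' : (f + 1)%:~R <= z%:~R :> R by rewrite ler_int lezD1.
have xf : x <= (f + 1)%:~R by apply: ltW.
rewrite !ler0_norm ?subr_le0 ?(le_trans xf) //.
by rewrite !opprB lerB.
Qed.

Lemma distZ_int x (z : int) : distZ (x + z%:~R) = distZ x.
Proof.
congr inf; apply/seteqP; split=> _ [w _ <-].
  by exists (w - z) => //; rewrite intrB opprB addrA addrAC.
by exists (w + z) => //; rewrite intrD opprD addrACA subrr addr0.
Qed.

Lemma circle_piE x y :
  (\pi_(circle R) x == \pi_(circle R) y) = (x - y \is a Num.int).
Proof. exact/esym/(Quotient.idealrBE (int_subgroup R)). Qed.

Lemma circle_normE x : circle_norm (\pi_(circle R) x) = distZ x.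
Proof.
rewrite /circle_norm; set y := repr _.
have : \pi_(circle R) y == \pi_(circle R) x by rewrite reprK.
rewrite circle_piE => /intrP[z yxz].
by rewrite -(subrK x y) yxz addrC distZ_int.
Qed.

Lemma circle_piMz x (z : int) :
  \pi_(circle R) x *~ z = \pi_(circle R) (x *~ z).
Proof. exact/esym/(raddfMz (\pi_(Quotient.quot (int_subgroup R)))). Qed.

End Facts.

(* Main.v *)
Require Import Defs.
From mathcomp Require Import all_boot all_order all_algebra.
From mathcomp Require Import generic_quotient.
From mathcomp Require Import boolp classical_sets functions cardinality.
From mathcomp Require Import reals.
From mathcomp Require Import zify lra.

(** If the support of [a] is in the ideal, every set
    [{n | ||a_n x|| >= e}] with [e > 0] is contained in it, so every [x] belongs to the
    characterized subgroup. The content is the converse: when the support is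
    positive, some [x] satisfies [||a_n x|| >= 1/4] for all [n] in a positive
    set.

    The failure of the Katetov reduction is used as a selection principle
    ([ideal_pos_constant_or_injective]): any function [g] on a positive set
    where [ED] is not reducible is constant or injective on some positive
    subset. Apply it on the support to the scale [g n], the integer part of
    [log_4 |a_n|].

    If the scale is constant on a positive set, [|a_n|] takes finitely many
    values there, hence one value [c > 0] on a positive set, and [x = 1/(2c)]
    gives [||a_n x|| = 1/2]. If the scale is injective on a positive set, keep
    the scales of one parity. The remaining [|a_n|], listed by increasing
    scale, grow at each step by a factor greater than [4], and for such a
    lacunary sequence nested intervals give an [x] keeping every multiple at
    distance at least [1/4] from the integers ([lacunary_distZ]). *)

Import Order.TTheory GRing.Theory Num.Theory.

Local Open Scope classical_set_scope.
Local Open Scope ring_scope.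

Lemma ideal_pos_pigeonhole {T : Type} {X : set T} {I : set (set T)}
    (hI : is_ideal X I) {N : nat} {A : set T} {h : T -> nat} :
  ~ I A -> (forall n, A n -> (h n < N)%N) ->
  exists i, ~ I (A `&` h @^-1` [set i]).
Proof.
elim: N A => [|N IHN] A nIA hN.
  case: nIA; suff -> : A = set0 by apply: (ideal_finite hI).
  by apply/seteqP; split=> // n /hN.
have [IN|] := pselect (I (A `&` h @^-1` [set N])); last by exists N.
have nIB : ~ I (A `\` h @^-1` [set N]).
  move=> IB; apply: nIA; apply: (ideal_down hI) (ideal_union hI IN IB) => n An.
  by have [hn|hn] := pselect (h n = N); [left|right].
have hB n : (A `\` h @^-1` [set N]) n -> (h n < N)%N.
  by move=> [An /= hnN]; have := hN n An; lia.
have [i nIi] := IHN _ nIB hB.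
by exists i => IAi; apply: nIi; apply: (ideal_down hI) IAi => n [[An _] hn].
Qed.

Lemma not_katetov_ED_pos {T : Type} {I : set (set T)} {A : set T}
    (f : T -> nat * nat) :
  ~ katetov_le [set: nat * nat] ED A (ideal_restr I A) ->
  exists2 B, ED B & ~ I (A `&` f @^-1` B).
Proof.
move=> nK; apply: contrapT => nB; apply: nK; exists f; split=> // B EB.
exists (A `&` f @^-1` B); last by rewrite setIAC setIid.
by apply: contrapT => nI; apply: nB; exists B.
Qed.

(** The map [n |-> (g n, n)] pulls some [B] in [ED] back to a positive set.
    Either finitely many columns of [B] already pull back to a positive set,
    and then a single fibre of [g] is positive; or the other columns do, and
    these have boundedly many points each, so that finitely many colours
    suffice to tell apart the points of each column: [g] is injective on every
    colour class, and one class is positive. *)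
Lemma ideal_pos_constant_or_injective {I : set (set nat)} {A : set nat}
    (hI : is_ideal [set: nat] I) (g : nat -> nat) :
  ~ I A -> ~ katetov_le [set: nat * nat] ED A (ideal_restr I A) ->
  (exists i, ~ I (A `&` g @^-1` [set i])) \/
  (exists C, [/\ C `<=` A, ~ I C &
    forall m n, C m -> C n -> g m = g n -> m = n]).
Proof.
move=> nIA /(not_katetov_ED_pos (fun n => (g n, n)))[B [k [N BN]] nIB].
set AB := A `&` _ in nIB.
have [Ik|nIk] := pselect (I (AB `&` [set n | (g n <= k)%N])); last first.
  have gk n : (AB `&` [set n | (g n <= k)%N]) n -> (g n < k.+1)%N by case.
  have [i nIi] := ideal_pos_pigeonhole hI nIk gk.
  left; exists i => IAi; apply: nIi; apply: (ideal_down hI) IAi.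
  by move=> n [[[An _] _] gn].
right.
set D := AB `\` [set n | (g n <= k)%N].
have nID : ~ I D.
  move=> ID; apply: nIB; apply: (ideal_down hI) (ideal_union hI Ik ID) => n ABn.
  by have [gn|gn] := pselect (g n <= k)%N; [left|right].
(* [r i] colours the points of column [i] injectively with [N] colours. *)
have /choice[r rP] i : exists r : nat -> nat, (k < i)%N ->
    (forall j, B (i, j) -> (r j < N)%N) /\
    (forall j j', B (i, j) -> B (i, j') -> r j = r j' -> j = j').
  have [_|ki] := leqP i k; first by exists id.
  have /pcard_leP[h] := BN i ki.
  exists h => _; split=> [j Bj|j j' Bj Bj' hjj'].
    by have := 'funS_h; apply.
  by have := 'inj_h; apply; rewrite ?inE.
have DB n : D n -> (k < g n)%N /\ B (g n, n).
  by move=> [[_ Bn] /negP]; rewrite -ltnNge.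
have rN n : D n -> (r (g n) n < N)%N by move=> /DB[/rP[rN _] /rN].
have [c nIc] := ideal_pos_pigeonhole hI nID rN.
exists (D `&` (fun n => r (g n) n) @^-1` [set c]); split=> //.
  by move=> n [[[]]].
move=> m n [/DB[kg Bm] /= rm] [/DB[_ Bn] rn] gmn.
rewrite -gmn in Bn rn.
by apply: (rP _ kg).2 => //; rewrite rm rn.
Qed.

Lemma nested_intervals (R : realType) (l r : nat -> R) :
  (forall k, l k <= r k) -> (forall k, l k <= l k.+1) ->
  (forall k, r k.+1 <= r k) -> exists x, forall k, l k <= x <= r k.
Proof.
move=> lr lS rS.
have lmono : {homo l : i j / (i <= j)%N >-> i <= j}.
  exact: (homo_leq (@lexx _ R) (@le_trans _ R)) lS.
have rmono : {homo r : i j / (i <= j)%N >-> j <= i}.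
  apply: (homo_leq (r := fun x y : R => y <= x)) rS => // y x z.
  by move=> yx zy; apply: le_trans zy yx.
have lr_all i j : l i <= r j.
  apply: le_trans (lmono _ _ (leq_maxl i j)) _.
  exact: le_trans (lr _) (rmono _ _ (leq_maxr i j)).
exists (sup (range l)) => k; apply/andP; split.
  by apply: ub_le_sup; [exists (r 0%N) => _ [i _ <-]|exists k].
by apply: ge_sup; [exists (l 0%N); exists 0%N|move=> _ [i _ <-]].
Qed.

Lemma distZ_ge_quarter (R : realType) (y : R) (z : int) :
  z%:~R + 1 / 4 <= y <= z%:~R + 3 / 4 -> 1 / 4 <= distZ y.
Proof.
move=> /andP[zy yz]; have [[w ->] _] := distZ_attained y.
rewrite ler_normr; have [wz|zw] := leP w z.
  have wzR : w%:~R <= z%:~R :> R by rewrite ler_int.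
  by apply/orP; left; lra.
have : (z + 1)%:~R <= w%:~R :> R by rewrite ler_int lezD1.
rewrite intrD => zw1.
by apply/orP; right; lra.
Qed.

Lemma distZ_absz (R : realType) (x : R) (a : int) :
  distZ (x *~ a) = distZ (x *+ `|a|%N).
Proof.
case: a => n //; rewrite NegzE mulrNz abszN absz_nat pmulrn.
have [[v vE] vle] := distZ_attained (- (x *~ n.+1)).
have [[w wE] wle] := distZ_attained (x *~ n.+1).
apply/eqP; rewrite eq_le {1}wE {2}vE; apply/andP; split.
  by have := vle (- w); rewrite -normrN intrN opprD !opprK.
by have := wle (- v); rewrite -normrN intrN opprD !opprK.
Qed.

(** The product [x * b k] is at distance at least [1/4] from the integers exactly
    when [x] lies in some interval
    [[(z + 1/4) / b k, (z + 3/4) / b k]] with [z] an integer. Such an interval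
    has length [1 / (2 b k)], hence length at least [3/2] when measured in units
    of [1 / b k.+1]; every interval of length [3/2] contains some
    [[z' + 1/4, z' + 3/4]], so these intervals can be chosen nested. *)
Lemma lacunary_distZ (R : realType) (b : nat -> nat) :
  (0 < b 0)%N -> (forall k, (3 * b k <= b k.+1)%N) ->
  exists x : R, forall k, 1 / 4 <= distZ (x *+ b k).
Proof.
move=> b0 b3.
have bpos k : 0 < (b k)%:R :> R.
  by rewrite ltr0n; elim: k => // k IHk; have := b3 k; lia.
(* The least [z'] whose interval starts no earlier than the previous
   one, in units of [1 / b k.+1]. *)
pose next k (z : int) : int :=
  Num.ceil ((z%:~R + 1 / 4) * ((b k.+1)%:R / (b k)%:R) - 1 / 4 : R).
pose z : nat -> int := fix z k := if k is k'.+1 then next k' (z k') else 0.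
pose l k : R := ((z k)%:~R + 1 / 4) / (b k)%:R.
pose r k : R := ((z k)%:~R + 3 / 4) / (b k)%:R.
have stepP k : l k <= l k.+1 /\ r k.+1 <= r k.
  rewrite /l /r /= /next.
  set t := (b k.+1)%:R / (b k)%:R; set y := _ - _.
  have tE : (b k)%:R^-1 = t / (b k.+1)%:R :> R.
    by rewrite /t mulrAC divff ?mul1r // lt0r_neq0.
  have t3 : 3 <= t by rewrite ler_pdivlMr // -natrM ler_nat.
  have y1 : y <= (Num.ceil y)%:~R by apply: ceil_ge.
  have y2 : (Num.ceil y)%:~R < y + 1 by have := ceilB1_lt y; rewrite intrB; lra.
  move: (Num.ceil y)%:~R y1 y2 => c; rewrite /y => y1 y2.
  by rewrite tE !(mulrA _ t); split; rewrite ler_pM2r ?invr_gt0 //; lra.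
have [x xP] : exists x, forall k, l k <= x <= r k.
  apply: nested_intervals => k; last 2 first.
  - by case: (stepP k).
  - by case: (stepP k).
  by rewrite /l /r ler_pM2r ?invr_gt0 // lerD2l; lra.
exists x => k; apply: (@distZ_ge_quarter _ _ (z k)).
have := xP k; rewrite /l /r (ler_pdivrMr _ _ (bpos k)).
by rewrite (ler_pdivlMr _ _ (bpos k)) mulr_natr.
Qed.

(** Two integers whose base-4 scales differ by at least [2] have ratio greater
    than [4], which is why fixing the parity of the scales gives lacunarity.
    The scales attained on [C] may have gaps; there the lacunary sequence is
    completed by powers of [4]. *)
Lemma separated_scales_distZ (R : realType) (C : set nat) (v : nat -> nat)
    (p : bool) :
  (forall n, C n -> (0 < v n)%N) ->
  (forall n, C n -> odd (trunc_log 4 (v n)) = p) ->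
  (forall m n, C m -> C n -> trunc_log 4 (v m) = trunc_log 4 (v n) -> m = n) ->
  exists x : R, forall n, C n -> 1 / 4 <= distZ (x *+ v n).
Proof.
move=> vpos vodd vinj.
have /choice[b bP] k : exists w,
    (4 ^ (p + k.*2) <= w < 4 ^ (p + k.*2).+1)%N /\
    forall n, C n -> trunc_log 4 (v n) = (p + k.*2)%N -> w = v n.
  have [[n [Cn vn]]|nC] :=
      pselect (exists n, C n /\ trunc_log 4 (v n) = (p + k.*2)%N).
    exists (v n); split; first by rewrite -vn; apply/trunc_log_bounds/vpos.
    by move=> m Cm vm; rewrite (vinj m n) // vm vn.
  exists (4 ^ (p + k.*2))%N; split; first by rewrite leqnn ltn_exp2l ?ltnSn.
  by move=> n Cn vn; case: nC; exists n.
have [||x xP] := @lacunary_distZ R b.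
- by apply: leq_trans (proj1 (andP (bP 0%N).1)); rewrite expn_gt0.
- move=> k; have /andP[_ bk] := (bP k).1; have /andP[bk1 _] := (bP k.+1).1.
  move: bk bk1; rewrite doubleS !addnS !expnS; lia.
exists x => n Cn; pose k := (trunc_log 4 (v n))./2.
rewrite -((bP k).2 n Cn); first exact: xP.
by rewrite -(vodd n Cn) odd_double_half.
Qed.

Lemma ideal_pos_distZ (R : realType) {I : set (set nat)} (v : nat -> nat)
    (hI : is_ideal [set: nat] I) :
  ~ I [set n | v n != 0%N] ->
  ~ katetov_le [set: nat * nat] ED [set n | v n != 0%N]
      (ideal_restr I [set n | v n != 0%N]) ->
  exists x : R, ~ I [set n | 1 / 4 <= distZ (x *+ v n)].
Proof.
move=> nIA nK.
suff [C [x [nIC xC]]] : exists (C : set nat) (x : R), ~ I C /\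
    forall n, C n -> 1 / 4 <= distZ (x *+ v n).
  by exists x => Ix; apply: nIC; apply: (ideal_down hI) Ix.
pose g n := trunc_log 4 (v n).
have [[s nIs]|[C [CA nIC Cinj]]] := ideal_pos_constant_or_injective hI g nIA nK.
- have vlt n : ([set n | v n != 0%N] `&` g @^-1` [set s]) n ->
      (v n < 4 ^ s.+1)%N.
    by move=> [_ <-]; apply: trunc_log_ltn.
  have [c nIc] := ideal_pos_pigeonhole hI nIs vlt.
  set D := (_ `&` v @^-1` _) in nIc; exists D, (1 / 2 / c%:R); split=> //.
  move=> n [[/= vn _] /= vnc]; apply: (@distZ_ge_quarter _ _ 0).
  have cn0 : c%:R != 0 :> R by rewrite pnatr_eq0 -vnc.
  by rewrite vnc -[_ *+ c]mulr_natr divfK //; lra.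
- have godd n : C n -> (odd (g n) < 2)%N by case: odd.
  have [p nIp] := ideal_pos_pigeonhole hI nIC godd.
  set D := (C `&` _) in nIp.
  suff [x xD] : exists x : R, forall n, D n -> 1 / 4 <= distZ (x *+ v n).
    by exists D, x.
  apply: (@separated_scales_distZ _ _ _ (odd p)).
  + by move=> n [/CA /=]; rewrite lt0n.
  + by move=> n [_ /= <-]; rewrite oddb.
  + by move=> m n [Cm _] [Cn _]; apply: Cinj.
Qed.

Theorem theorem2p22 (R : realType) (I : set (set nat))
    (hI : is_ideal [set: nat] I)
    (hED : forall A : set nat, ideal_pos [set: nat] I A ->
      ~ katetov_le [set: nat * nat] ED A (ideal_restr I A)) :
  forall a : nat -> int,
    H_set a I = [set: circle R] <-> I (supp a).
Proof.
move=> a; split=> [HT|Ia]; last first.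
  apply/seteqP; split=> // x _ e e0; apply: (ideal_down hI) Ia => n /= en.
  apply/eqP => an0; move: en; rewrite an0 mulr0z leNgt.
  suff -> : circle_norm (0 : circle R) = 0 by rewrite e0.
  have -> : 0 = \pi_(circle R)%qT 0 :> circle R.
    by have := @circle_piMz R 0 0; rewrite !mulr0z.
  rewrite circle_normE; have [[z zE] zle] := @distZ_attained R 0.
  apply/eqP; rewrite eq_le {2}zE normr_ge0 (le_trans (zle 0)) //.
  by rewrite subrr normr0.
apply: contrapT => nIa.
have suppE : supp a = [set n | `|a n|%N != 0%N].
  by apply/seteqP; split=> n /=; rewrite /supp /= absz_eq0.
have nK := hED _ (conj (@subsetT _ (supp a)) nIa).
rewrite suppE in nIa nK.
have [x] := ideal_pos_distZ R (fun n => `|a n|%N) hI nIa nK; apply.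
have : H_set a I (\pi_(circle R)%qT x) by rewrite HT.
move=> /(_ (1 / 4)); rewrite divr_gt0 // => /(_ isT).
by apply: (ideal_down hI) => n /=; rewrite circle_piMz circle_normE distZ_absz.
Qed.
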